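(* Let $S$ be an additive abelian group and $\chi:S\to\mathbb{C}^\times$ a group homomorphism. The Lie algebra $\widehat{A}_S$ admits an automorphism $\sigma$ such that $$\sigma(A_{\alpha,m})=\chi(\alpha)A_{\alpha,m}\quad\text{for }\alpha\in S,\ m\in\mathbb{Z}.$$ Furthermore, $\tau_B=\sigma\tau_C\sigma^{-1}$ and $\widehat{B}_S\simeq\widehat{C}_S$.
   Context: $\widehat{A}_S$ is the complex Lie algebra generated by $\mathbf{c}$ and $A_{\alpha,m}$ ($\alpha\in S$, $m\in\mathbb{Z}$) subject to the relations that $\mathbf{c}$ is central and $$[A_{\alpha,m},A_{\beta,n}]=(\chi(m\beta-n\alpha)-\chi(n\alpha-m\beta))A_{\alpha+\beta,m+n}+m\delta_{\alpha+\beta,0}\delta_{m+n,0}\mathbf{c};$$ these generators form a basis. $\tau_B,\tau_C$ are the order-2 automorphisms of $\widehat{A}_S$ with $\tau_B(\mathbf{c})=\tau_C(\mathbf{c})=\mathbf{c}$, $\tau_B(A_{\alpha,m})=-(-1)^mA_{-\alpha,m}$, $\tau_C(A_{\alpha,m})=-(-1)^m\chi(2\alpha)A_{-\alpha,m}$. $\widehat{B}_S$ and $\widehat{C}_S$ are the subalgebras of fixed points of $\tau_B$ and $\tau_C$ in $\widehat{A}_S$, respectively. *)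

(* Defs.v *)
From HB Require Import structures.
From mathcomp Require Import all_boot all_order all_algebra.
From mathcomp Require Import ring.
From mathcomp Require Import boolp reals.
From mathcomp.real_closed Require Import complex.

Set Implicit Arguments.
Unset Strict Implicit.
Unset Printing Implicit Defensive.

Import GRing.Theory.
Local Open Scope ring_scope.
Local Open Scope quotient_scope.

HB.mixin Record Lmodule_isLie (K : fieldType) L of GRing.Lmodule K L := {
  lie : L -> L -> L;
  lieDl : forall x y z, lie (x + y) z = lie x z + lie y z;
  lieDr : forall x y z, lie x (y + z) = lie x y + lie x z;
  lieZl : forall a x y, lie (a *: x) y = a *: lie x y;
  lieZr : forall a x y, lie x (a *: y) = a *: lie x y;
  liexx : forall x, lie x x = 0;
  lie_jacobi : forall x y z,
    lie x (lie y z) + lie y (lie z x) + lie z (lie x y) = 0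
}.

#[short(type="lieAlgType")]
HB.structure Definition LieAlgebra (K : fieldType) :=
  {L of GRing.Lmodule K L & Lmodule_isLie K L}.

Record lieIso (K : fieldType) (L M : lieAlgType K) := LieIso {
  iso_fun :> {linear L -> M};
  iso_inv : M -> L;
  iso_lie : {morph iso_fun : x y / lie x y};
  iso_funK : cancel iso_fun iso_inv;
  iso_invK : cancel iso_inv iso_fun
}.

Notation lieAut L := (lieIso L L).

Definition lie_isomorphic (K : fieldType) (L M : lieAlgType K) : Prop :=
  inhabited (lieIso L M).

Section FixedPoints.
Variables (K : fieldType) (L : lieAlgType K) (tau : lieAut L).

Definition fixed_pred : {pred L} := fun x => tau x == x.

Fact fixed_subsemimod_closed : GRing.subsemimod_closed fixed_pred.
Proof.
split; first split=> [|x y].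
- by rewrite unfold_in linear0.
- by rewrite !unfold_in => /eqP hx /eqP hy; rewrite linearD hx hy.
- by move=> a x; rewrite !unfold_in => /eqP hx; rewrite linearZ /= hx.
Qed.

HB.instance Definition _ :=
  GRing.isSubmodClosed.Build K L fixed_pred fixed_subsemimod_closed.

Record fixedLie := FixedLie { fixed_val : L; _ : fixed_val \in fixed_pred }.

HB.instance Definition _ := [isSub for fixed_val].
HB.instance Definition _ := [Choice of fixedLie by <:].
HB.instance Definition _ := [SubChoice_isSubLmodule of fixedLie by <:].

Fact fixed_lie_closed (x y : fixedLie) : lie (val x) (val y) \in fixed_pred.
Proof.
case: x y => [x hx] [y hy] /=; move: hx hy; rewrite !unfold_in.
by move=> /eqP hx /eqP hy; rewrite iso_lie hx hy.
Qed.

Definition fixed_lie (x y : fixedLie) : fixedLie :=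
  FixedLie (fixed_lie_closed x y).

Lemma fixed_val0 : fixed_val 0 = 0. Proof. exact: (raddf0 val). Qed.
Lemma fixed_valD x y : fixed_val (x + y) = fixed_val x + fixed_val y.
Proof. exact: (raddfD val). Qed.
Lemma fixed_valZ a x : fixed_val (a *: x) = a *: fixed_val x.
Proof. exact: (linearZZ (val : {linear fixedLie -> L})). Qed.

Fact fixed_lieDl x y z :
  fixed_lie (x + y) z = fixed_lie x z + fixed_lie y z.
Proof. by apply: val_inj; rewrite /= lieDl. Qed.
Fact fixed_lieDr x y z :
  fixed_lie x (y + z) = fixed_lie x y + fixed_lie x z.
Proof. by apply: val_inj; rewrite /= lieDr. Qed.
Fact fixed_lieZl a x y : fixed_lie (a *: x) y = a *: fixed_lie x y.
Proof. by apply: val_inj; rewrite /= lieZl. Qed.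
Fact fixed_lieZr a x y : fixed_lie x (a *: y) = a *: fixed_lie x y.
Proof. by apply: val_inj; rewrite /= lieZr. Qed.
Fact fixed_liexx x : fixed_lie x x = 0.
Proof. by apply: val_inj; rewrite /= liexx. Qed.
Fact fixed_jacobi x y z :
  fixed_lie x (fixed_lie y z) + fixed_lie y (fixed_lie z x)
    + fixed_lie z (fixed_lie x y) = 0.
Proof.
by apply: val_inj; rewrite /= lie_jacobi.
Qed.

HB.instance Definition _ := Lmodule_isLie.Build K fixedLie
  fixed_lieDl fixed_lieDr fixed_lieZl fixed_lieZr fixed_liexx fixed_jacobi.

End FixedPoints.

(* The Lie algebra presented by generators X and relations rel: Lie words    *)
(* modulo the smallest congruence containing rel and the Lie algebra axioms. *)
Inductive lie_word (K X : Type) :=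
| LGen of X
| LZero
| LAdd of lie_word K X & lie_word K X
| LScale of K & lie_word K X
| LBr of lie_word K X & lie_word K X.

Arguments LGen {K X}.
Arguments LZero {K X}.

HB.instance Definition _ (K X : Type) := gen_eqMixin (lie_word K X).
HB.instance Definition _ (K X : Type) := gen_choiceMixin (lie_word K X).

Section Presentation.
Variables (K : fieldType) (X : Type).
Variable rel : lie_word K X -> lie_word K X -> Prop.

Inductive lie_cong : lie_word K X -> lie_word K X -> Prop :=
| lc_rel s t : rel s t -> lie_cong s t
| lc_refl s : lie_cong s s
| lc_sym s t : lie_cong s t -> lie_cong t s
| lc_trans s t u : lie_cong s t -> lie_cong t u -> lie_cong s u
| lc_add s s' t t' :
    lie_cong s s' -> lie_cong t t' -> lie_cong (LAdd s t) (LAdd s' t')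
| lc_scale a s s' : lie_cong s s' -> lie_cong (LScale a s) (LScale a s')
| lc_br s s' t t' :
    lie_cong s s' -> lie_cong t t' -> lie_cong (LBr s t) (LBr s' t')
| lc_addA s t u : lie_cong (LAdd s (LAdd t u)) (LAdd (LAdd s t) u)
| lc_addC s t : lie_cong (LAdd s t) (LAdd t s)
| lc_add0 s : lie_cong (LAdd LZero s) s
| lc_addN s : lie_cong (LAdd (LScale (-1) s) s) LZero
| lc_scaleA a b s : lie_cong (LScale a (LScale b s)) (LScale (a * b) s)
| lc_scale1 s : lie_cong (LScale 1 s) s
| lc_scaleDr a s t :
    lie_cong (LScale a (LAdd s t)) (LAdd (LScale a s) (LScale a t))
| lc_scaleDl a b s :
    lie_cong (LScale (a + b) s) (LAdd (LScale a s) (LScale b s))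
| lc_brDl s t u : lie_cong (LBr (LAdd s t) u) (LAdd (LBr s u) (LBr t u))
| lc_brDr s t u : lie_cong (LBr s (LAdd t u)) (LAdd (LBr s t) (LBr s u))
| lc_brZl a s t : lie_cong (LBr (LScale a s) t) (LScale a (LBr s t))
| lc_brZr a s t : lie_cong (LBr s (LScale a t)) (LScale a (LBr s t))
| lc_brxx s : lie_cong (LBr s s) LZero
| lc_jacobi s t u :
    lie_cong (LAdd (LAdd (LBr s (LBr t u)) (LBr t (LBr u s)))
                   (LBr u (LBr s t))) LZero.

Definition lie_congb (s t : lie_word K X) : bool := `[< lie_cong s t >].

Fact lie_congb_refl : reflexive lie_congb.
Proof. by move=> s; apply/asboolP; exact: lc_refl. Qed.
Fact lie_congb_sym : symmetric lie_congb.
Proof. by move=> s t; apply/asboolP/asboolP; exact: lc_sym. Qed.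
Fact lie_congb_trans : transitive lie_congb.
Proof.
move=> t s u /asboolP st /asboolP tu; apply/asboolP; exact: lc_trans st tu.
Qed.

Canonical lie_congb_equiv :=
  EquivRel lie_congb lie_congb_refl lie_congb_sym lie_congb_trans.

Definition presLie := {eq_quot lie_congb}.

HB.instance Definition _ := Choice.on presLie.

Definition pres_word (s : lie_word K X) : presLie := \pi_presLie s.

Definition pres_gen (x : X) : presLie := pres_word (LGen x).

Lemma pres_wordP s t : pres_word s = pres_word t <-> lie_cong s t.
Proof.
split=> [/eqmodP|st]; first by move/asboolP.
by apply/eqmodP/asboolP.
Qed.

Lemma pres_wordK x : pres_word (repr x) = x.
Proof. exact: reprK. Qed.

Lemma repr_pres_word s : lie_cong (repr (pres_word s)) s.
Proof. by apply/pres_wordP; rewrite pres_wordK. Qed.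

Definition pres_zero : presLie := pres_word LZero.
Definition pres_add (x y : presLie) := pres_word (LAdd (repr x) (repr y)).
Definition pres_scale a (x : presLie) := pres_word (LScale a (repr x)).
Definition pres_lie (x y : presLie) := pres_word (LBr (repr x) (repr y)).

Lemma pres_addE s t :
  pres_add (pres_word s) (pres_word t) = pres_word (LAdd s t).
Proof. by apply/pres_wordP/lc_add; exact: repr_pres_word. Qed.
Lemma pres_scaleE a s : pres_scale a (pres_word s) = pres_word (LScale a s).
Proof. by apply/pres_wordP/lc_scale; exact: repr_pres_word. Qed.
Lemma pres_lieE s t :
  pres_lie (pres_word s) (pres_word t) = pres_word (LBr s t).
Proof. by apply/pres_wordP/lc_br; exact: repr_pres_word. Qed.

Let presE := (pres_addE, pres_scaleE, pres_lieE).

Fact pres_addA : associative pres_add.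
Proof.
move=> x y z; rewrite -[x]pres_wordK -[y]pres_wordK -[z]pres_wordK !presE.
exact/pres_wordP/lc_addA.
Qed.
Fact pres_addC : commutative pres_add.
Proof. by move=> x y; apply/pres_wordP/lc_addC. Qed.
Fact pres_add0 : left_id pres_zero pres_add.
Proof.
by move=> x; rewrite -[x]pres_wordK presE; apply/pres_wordP/lc_add0.
Qed.
Fact pres_addN : left_inverse pres_zero (pres_scale (-1)) pres_add.
Proof.
by move=> x; rewrite -[x]pres_wordK !presE; apply/pres_wordP/lc_addN.
Qed.

HB.instance Definition _ :=
  GRing.isZmodule.Build presLie pres_addA pres_addC pres_add0 pres_addN.

Fact pres_scaleA a b x : pres_scale a (pres_scale b x) = pres_scale (a * b) x.
Proof. by rewrite -[x]pres_wordK !presE; apply/pres_wordP/lc_scaleA. Qed.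
Fact pres_scale1 : left_id 1 pres_scale.
Proof.
by move=> x; rewrite -[x]pres_wordK presE; apply/pres_wordP/lc_scale1.
Qed.
Fact pres_scaleDr : right_distributive pres_scale +%R.
Proof.
move=> a x y; rewrite -[x]pres_wordK -[y]pres_wordK /GRing.add /= !presE.
exact/pres_wordP/lc_scaleDr.
Qed.
Fact pres_scaleDl x : {morph pres_scale^~ x : a b / a + b}.
Proof.
move=> a b; rewrite -[x]pres_wordK !presE [RHS]pres_addE.
exact/pres_wordP/lc_scaleDl.
Qed.

HB.instance Definition _ := GRing.Zmodule_isLmodule.Build K presLie
  pres_scaleA pres_scale1 pres_scaleDr pres_scaleDl.

Lemma pres_word0 : pres_word LZero = 0. Proof. by []. Qed.
Lemma pres_wordD s t : pres_word (LAdd s t) = pres_word s + pres_word t.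
Proof. by rewrite -pres_addE. Qed.
Lemma pres_wordZ a s : pres_word (LScale a s) = a *: pres_word s.
Proof. by rewrite -pres_scaleE. Qed.

Fact pres_lieDl x y z : pres_lie (x + y) z = pres_lie x z + pres_lie y z.
Proof.
rewrite -[x]pres_wordK -[y]pres_wordK -[z]pres_wordK.
rewrite -pres_wordD !pres_lieE -pres_wordD.
exact/pres_wordP/lc_brDl.
Qed.
Fact pres_lieDr x y z : pres_lie x (y + z) = pres_lie x y + pres_lie x z.
Proof.
rewrite -[x]pres_wordK -[y]pres_wordK -[z]pres_wordK.
rewrite -pres_wordD !pres_lieE -pres_wordD.
exact/pres_wordP/lc_brDr.
Qed.
Fact pres_lieZl a x y : pres_lie (a *: x) y = a *: pres_lie x y.
Proof.
rewrite -[x]pres_wordK -[y]pres_wordK.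
rewrite -pres_wordZ !pres_lieE -pres_wordZ.
exact/pres_wordP/lc_brZl.
Qed.
Fact pres_lieZr a x y : pres_lie x (a *: y) = a *: pres_lie x y.
Proof.
rewrite -[x]pres_wordK -[y]pres_wordK.
rewrite -pres_wordZ !pres_lieE -pres_wordZ.
exact/pres_wordP/lc_brZr.
Qed.
Fact pres_liexx x : pres_lie x x = 0.
Proof.
by rewrite -[x]pres_wordK pres_lieE; apply/pres_wordP/lc_brxx.
Qed.
Fact pres_jacobi x y z :
  pres_lie x (pres_lie y z) + pres_lie y (pres_lie z x)
    + pres_lie z (pres_lie x y) = 0.
Proof.
rewrite -[x]pres_wordK -[y]pres_wordK -[z]pres_wordK.
rewrite !pres_lieE -!pres_wordD.
exact/pres_wordP/lc_jacobi.
Qed.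

HB.instance Definition _ := Lmodule_isLie.Build K presLie
  pres_lieDl pres_lieDr pres_lieZl pres_lieZr pres_liexx pres_jacobi.

Lemma pres_wordBr s t : pres_word (LBr s t) = lie (pres_word s) (pres_word t).
Proof. by rewrite -pres_lieE. Qed.

Section Lift.
Variables (L : lieAlgType K) (f : X -> L).

Fixpoint word_eval (s : lie_word K X) : L :=
  match s with
  | LGen x => f x
  | LZero => 0
  | LAdd s t => word_eval s + word_eval t
  | LScale a s => a *: word_eval s
  | LBr s t => lie (word_eval s) (word_eval t)
  end.

Definition respects_rel := forall s t, rel s t -> word_eval s = word_eval t.

Hypothesis fP : respects_rel.

Lemma word_eval_cong s t : lie_cong s t -> word_eval s = word_eval t.
Proof.
elim=> {s t} //=.
- by move=> s t u _ -> _ ->.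
- by move=> s s' t t' _ -> _ ->.
- by move=> a s s' _ ->.
- by move=> s s' t t' _ -> _ ->.
- by move=> s t u; rewrite addrA.
- by move=> s t; rewrite addrC.
- by move=> s; rewrite add0r.
- by move=> s; rewrite scaleN1r addNr.
- by move=> a b s; rewrite scalerA.
- by move=> s; rewrite scale1r.
- by move=> a s t; rewrite scalerDr.
- by move=> a b s; rewrite scalerDl.
- by move=> s t u; rewrite lieDl.
- by move=> s t u; rewrite lieDr.
- by move=> a s t; rewrite lieZl.
- by move=> a s t; rewrite lieZr.
- by move=> s; rewrite liexx.
- by move=> s t u; rewrite lie_jacobi.
Qed.

Definition pres_lift of respects_rel := fun x : presLie => word_eval (repr x).

Lemma pres_lift_word s : pres_lift fP (pres_word s) = word_eval s.
Proof. by apply/word_eval_cong/repr_pres_word. Qed.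

Fact pres_lift_is_linear : linear (pres_lift fP).
Proof.
move=> a x y; rewrite -[x]pres_wordK -[y]pres_wordK.
by rewrite -pres_wordZ -pres_wordD !pres_lift_word.
Qed.

HB.instance Definition _ := GRing.isLinear.Build K presLie L *:%R
  (pres_lift fP) pres_lift_is_linear.

Lemma pres_lift_lie : {morph pres_lift fP : x y / lie x y}.
Proof.
move=> x y; rewrite -[x]pres_wordK -[y]pres_wordK.
by rewrite -pres_wordBr !pres_lift_word.
Qed.

Lemma pres_lift_gen x : pres_lift fP (pres_gen x) = f x.
Proof. by rewrite pres_lift_word. Qed.

End Lift.

Lemma pres_lift_unique (L : lieAlgType K) (g h : {linear presLie -> L}) :
  {morph g : x y / lie x y} -> {morph h : x y / lie x y} ->
  (forall x, g (pres_gen x) = h (pres_gen x)) -> g =1 h.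
Proof.
move=> gL hL gh x; rewrite -[x]pres_wordK; elim: (repr x) => {x} /=.
- exact: gh.
- by rewrite pres_word0 !linear0.
- by move=> s IHs t IHt; rewrite pres_wordD !linearD IHs IHt.
- by move=> a s IHs; rewrite pres_wordZ !linearZ /= IHs.
- by move=> s IHs t IHt; rewrite pres_wordBr gL hL IHs IHt.
Qed.

Lemma pres_lift_involutive (f : X -> presLie) (fP : respects_rel f) :
  (forall x, pres_lift fP (f x) = pres_gen x) -> involutive (pres_lift fP).
Proof.
move=> ffK; pose ff : {linear presLie -> presLie} :=
  pres_lift fP \o pres_lift fP.
apply: (@pres_lift_unique _ ff idfun) => [x y||x] //=.
  by rewrite !pres_lift_lie.
by rewrite pres_lift_gen ffK.
Qed.

Definition pres_invol (f : X -> presLie) (fP : respects_rel f)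
    (ffK : forall x, pres_lift fP (f x) = pres_gen x) : lieAut presLie :=
  LieIso (pres_lift_lie fP)
    (pres_lift_involutive ffK) (pres_lift_involutive ffK).

End Presentation.

(* Group homomorphisms from S to the multiplicative group of K. *)
Record mult_char (S : zmodType) (K : fieldType) := MultChar {
  char_fun :> S -> K;
  char_neq0 : forall a, char_fun a != 0;
  charD : {morph char_fun : a b / a + b >-> a * b}
}.

Section AHat.
Variables (K : fieldType) (S : zmodType) (chi : mult_char S K).

Inductive A_gen := GenC | GenA of S & int.

Notation wC := (LGen GenC).
Notation wA a m := (LGen (GenA a m)).

Inductive A_rel : lie_word K A_gen -> lie_word K A_gen -> Prop :=
| A_rel_central t : A_rel (LBr wC t) LZero
| A_rel_bracket a m b n :
    A_rel (LBr (wA a m) (wA b n))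
      (LAdd
        (LScale (chi (b *~ m - a *~ n) - chi (a *~ n - b *~ m))
          (wA (a + b) (m + n)))
        (LScale (m%:~R * (a + b == 0)%:R * (m + n == 0)%:R) wC)).

Definition Ahat := presLie A_rel.

HB.instance Definition _ := LieAlgebra.on Ahat.

Definition cA : Ahat := pres_gen A_rel GenC.
Definition A_ (a : S) (m : int) : Ahat := pres_gen A_rel (GenA a m).

Lemma cA_central x : lie cA x = 0.
Proof.
rewrite -[x]pres_wordK -pres_wordBr -pres_word0.
exact/pres_wordP/lc_rel/A_rel_central.
Qed.

Lemma A_bracket a m b n :
  lie (A_ a m) (A_ b n) =
    (chi (b *~ m - a *~ n) - chi (a *~ n - b *~ m)) *: A_ (a + b) (m + n)
    + (m%:~R * (a + b == 0)%:R * (m + n == 0)%:R) *: cA.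
Proof.
rewrite -pres_wordBr -!pres_wordZ -pres_wordD.
exact/pres_wordP/lc_rel/A_rel_bracket.
Qed.

Lemma char0 : chi 0 = 1.
Proof.
apply: (mulfI (char_neq0 chi 0)); rewrite mulr1 -charD addr0 //.
Qed.

Lemma charN a : chi a * chi (- a) = 1.
Proof. by rewrite -charD subrr char0. Qed.

Definition tauB_gen (g : A_gen) : Ahat :=
  match g with
  | GenC => cA
  | GenA a m => - (-1) ^ m *: A_ (- a) m
  end.

Definition tauC_gen (g : A_gen) : Ahat :=
  match g with
  | GenC => cA
  | GenA a m => (- (-1) ^ m * chi (a *+ 2)) *: A_ (- a) m
  end.

Lemma signzD (m n : int) : (-1) ^ (m + n) = (-1) ^ m * (-1) ^ n :> K.
Proof. by rewrite expfzDr // oppr_eq0 oner_neq0. Qed.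

Lemma signz_sqr (m : int) : (-1) ^ m * (-1) ^ m = 1 :> K.
Proof. by rewrite -expfzMl mulrNN mulr1 exp1rz. Qed.

Lemma tauB_respects : respects_rel A_rel tauB_gen.
Proof.
move=> _ _ [t|a m b n] /=; first exact: cA_central.
rewrite lieZl lieZr A_bracket !scalerDr !scalerA -opprD oppr_eq0.
rewrite !mulNrz !opprK ![- _ + _]addrC signzD.
congr (_ *: _ + _ *: _); first by ring.
have [mn|] := eqVneq (m + n) 0; last by rewrite !mulr0.
by rewrite mulrNN -signzD mn expr0z mul1r.
Qed.

Lemma tauC_respects : respects_rel A_rel tauC_gen.
Proof.
move=> _ _ [t|a m b n] /=; first exact: cA_central.
rewrite lieZl lieZr A_bracket !scalerDr !scalerA -opprD oppr_eq0.
rewrite !mulNrz !opprK ![- _ + _]addrC signzD mulrnDl [chi (a *+ 2 + _)]charD.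
congr (_ *: _ + _ *: _); first by ring.
have [mn|] := eqVneq (m + n) 0; last by rewrite !mulr0.
have [ab|] := eqVneq (a + b) 0; last by rewrite !(mulr0, mul0r).
have -> : - (-1) ^ m * chi (a *+ 2) * (- (-1) ^ n * chi (b *+ 2)) = 1.
  rewrite mulrACA mulrNN -signzD mn expr0z mul1r.
  by rewrite -charD -mulrnDl ab mul0rn char0.
by rewrite mul1r.
Qed.

Lemma tauB_genK g : pres_lift tauB_respects (tauB_gen g) = pres_gen A_rel g.
Proof.
case: g => [|a m] /=; first by rewrite pres_lift_gen.
rewrite linearZ /= pres_lift_gen /= scalerA mulrNN signz_sqr scale1r.
by rewrite opprK.
Qed.

Lemma tauC_genK g : pres_lift tauC_respects (tauC_gen g) = pres_gen A_rel g.
Proof.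
case: g => [|a m] /=; first by rewrite pres_lift_gen.
rewrite linearZ /= pres_lift_gen /= scalerA mulrACA mulrNN signz_sqr mul1r.
by rewrite mulNrn charN scale1r opprK.
Qed.

Definition tauB : lieAut Ahat := pres_invol tauB_genK.
Definition tauC : lieAut Ahat := pres_invol tauC_genK.

Lemma tauB_c : tauB cA = cA.
Proof. exact: pres_lift_gen. Qed.
Lemma tauB_A a m : tauB (A_ a m) = - (-1) ^ m *: A_ (- a) m.
Proof. exact: pres_lift_gen. Qed.
Lemma tauC_c : tauC cA = cA.
Proof. exact: pres_lift_gen. Qed.
Lemma tauC_A a m :
  tauC (A_ a m) = (- (-1) ^ m * chi (a *+ 2)) *: A_ (- a) m.
Proof. exact: pres_lift_gen. Qed.

Definition Bhat := fixedLie tauB.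
Definition Chat := fixedLie tauC.

HB.instance Definition _ := LieAlgebra.on Bhat.
HB.instance Definition _ := LieAlgebra.on Chat.

End AHat.

(* Main.v *)
Require Import Defs.
From HB Require Import structures.
From mathcomp Require Import all_boot all_order all_algebra.
From mathcomp Require Import boolp reals.
From mathcomp.real_closed Require Import complex.

Set Implicit Arguments.
Unset Strict Implicit.
Unset Printing Implicit Defensive.

Import GRing.Theory.
Local Open Scope ring_scope.

(** The bracket of the algebra is graded by [S]: [lie (A_ a m) (A_ b n)] is a
    multiple of [A_ (a + b) (m + n)] plus a central term that survives only in
    degree [a + b = 0].  Hence rescaling each [A_ a m] by [mu a], for any
    character [mu] of [S], and fixing [c], respects the defining relations
    ([twist]); the inverse character gives the inverse map.

    Take [sigma] to be the twist by [chi].  On [A_ a m], [sigma \o tauC]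
    multiplies the value of [tauB] by [chi (2a) * chi (-a)] and [tauB \o sigma]
    multiplies it by [chi a]; these are equal, so [sigma] intertwines [tauC]
    with [tauB] ([twist_tauC]).  An isomorphism that intertwines two
    automorphisms carries the fixed points of one onto those of the other
    ([fixed_iso]), whence the isomorphism of the two fixed-point algebras. *)

(** * Isomorphisms of Lie algebras *)

Section LieIsoInverse.
Variables (K : fieldType) (L M : lieAlgType K) (phi : lieIso L M).

Fact iso_inv_linear : linear (iso_inv phi).
Proof. exact: can2_linear (iso_funK phi) (iso_invK phi). Qed.

HB.instance Definition _ :=
  GRing.isLinear.Build K M L *:%R (iso_inv phi) iso_inv_linear.

Fact iso_inv_lie : {morph iso_inv phi : x y / lie x y}.
Proof.
by move=> x y; apply: (can_inj (iso_funK phi)); rewrite iso_lie !iso_invK.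
Qed.

Definition lieIso_sym : lieIso M L :=
  LieIso iso_inv_lie (iso_invK phi) (iso_funK phi).

End LieIsoInverse.

Section FixedPointsIso.
Variables (K : fieldType) (L M : lieAlgType K).
Variables (tauL : lieAut L) (tauM : lieAut M) (phi : lieIso L M).
Hypothesis phi_tau : forall x, phi (tauL x) = tauM (phi x).

Fact iso_fixed (x : fixedLie tauL) : phi (val x) \in fixed_pred tauM.
Proof.
by case: x => x /=; rewrite !unfold_in -phi_tau => /eqP->.
Qed.

Fact iso_inv_fixed (y : fixedLie tauM) :
  iso_inv phi (val y) \in fixed_pred tauL.
Proof.
case: y => y /=; rewrite !unfold_in => /eqP tau_y.
by rewrite -(inj_eq (can_inj (iso_funK phi))) phi_tau iso_invK tau_y.
Qed.

Definition fixed_map (x : fixedLie tauL) : fixedLie tauM :=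
  FixedLie (iso_fixed x).
Definition fixed_inv (y : fixedLie tauM) : fixedLie tauL :=
  FixedLie (iso_inv_fixed y).

Fact fixed_map_linear : linear fixed_map.
Proof. by move=> a x y; apply: val_inj; rewrite /= !linearP. Qed.

HB.instance Definition _ := GRing.isLinear.Build K
  (fixedLie tauL) (fixedLie tauM) *:%R fixed_map fixed_map_linear.

Fact fixed_map_lie : {morph fixed_map : x y / lie x y}.
Proof. by move=> x y; apply: val_inj; rewrite /= iso_lie. Qed.

Fact fixed_mapK : cancel fixed_map fixed_inv.
Proof. by move=> x; apply: val_inj; rewrite /= iso_funK. Qed.

Fact fixed_invK : cancel fixed_inv fixed_map.
Proof. by move=> x; apply: val_inj; rewrite /= iso_invK. Qed.

Definition fixed_iso : lieIso (fixedLie tauL) (fixedLie tauM) :=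
  LieIso fixed_map_lie fixed_mapK fixed_invK.

End FixedPointsIso.

(** * Rescaling by a character *)

Section InverseCharacter.
Variables (S : zmodType) (K : fieldType) (mu : mult_char S K).

Fact char_opp_neq0 a : mu (- a) != 0.
Proof. exact: char_neq0. Qed.

Fact char_oppD : {morph (fun a => mu (- a)) : a b / a + b >-> a * b}.
Proof. by move=> a b; rewrite opprD charD. Qed.

Definition char_inv : mult_char S K :=
  MultChar char_opp_neq0 char_oppD.

End InverseCharacter.

Section Twist.
Variables (K : fieldType) (S : zmodType) (chi : mult_char S K).

Definition twist_gen (mu : mult_char S K) (g : A_gen S) : Ahat chi :=
  match g with
  | GenC => cA chi
  | GenA a m => mu a *: A_ chi a m
  end.

(** The central term is left unscaled, which is consistent because it occurs
    only when [a + b = 0], where [mu a * mu b = mu 0 = 1]. *)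
Lemma twist_respects mu : respects_rel (A_rel chi) (twist_gen mu).
Proof.
move=> _ _ [t|a m b n] /=; first exact: cA_central.
rewrite lieZl lieZr A_bracket !scalerDr !scalerA -charD.
congr (_ *: _ + _ *: _); first by rewrite mulrC.
by have [->|] := eqVneq (a + b) 0; rewrite ?char0 ?mul1r // !(mulr0, mul0r).
Qed.

Definition twist mu : Ahat chi -> Ahat chi := pres_lift (twist_respects mu).

HB.instance Definition _ mu := GRing.Linear.on (twist mu).

Lemma twist_lie mu : {morph twist mu : x y / lie x y}.
Proof. exact: pres_lift_lie. Qed.

Lemma twist_c mu : twist mu (cA chi) = cA chi.
Proof. exact: pres_lift_gen. Qed.

Lemma twist_A mu a m : twist mu (A_ chi a m) = mu a *: A_ chi a m.
Proof. exact: pres_lift_gen. Qed.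

Lemma twistK (mu nu : mult_char S K) :
  (forall a, mu a * nu a = 1) -> cancel (twist mu) (twist nu).
Proof.
move=> mu_nu; pose tt : {linear Ahat chi -> Ahat chi} := twist nu \o twist mu.
apply: (@pres_lift_unique _ _ _ _ tt idfun) => [x y||[|a m]] //=.
- by rewrite !twist_lie.
- by rewrite !twist_c.
- by rewrite twist_A linearZ /= twist_A scalerA mu_nu scale1r.
Qed.

Fact twist_charK mu : cancel (twist mu) (twist (char_inv mu)).
Proof. by apply: twistK => a; rewrite charN. Qed.

Fact twist_char_invK mu : cancel (twist (char_inv mu)) (twist mu).
Proof. by apply: twistK => a; rewrite mulrC charN. Qed.

Definition twist_aut mu : lieAut (Ahat chi) :=
  LieIso (@twist_lie mu) (@twist_charK mu) (@twist_char_invK mu).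

(** Both sides are Lie morphisms, so it suffices to compare them on generators,
    where the claim is [chi (2a) * chi (-a) = chi a]. *)
Lemma twist_tauC x : twist chi (tauC chi x) = tauB chi (twist chi x).
Proof.
pose f : {linear Ahat chi -> Ahat chi} := twist chi \o tauC chi.
pose g : {linear Ahat chi -> Ahat chi} := tauB chi \o twist chi.
apply: (@pres_lift_unique _ _ _ _ f g) x => [x y|x y|[|a m]] /=.
- by rewrite pres_lift_lie twist_lie.
- by rewrite twist_lie pres_lift_lie.
- by rewrite tauC_c twist_c tauB_c.
- rewrite tauC_A twist_A !linearZ /= twist_A tauB_A !scalerA -mulrA -charD.
  by rewrite mulr2n addrK mulrC.
Qed.

End Twist.

Theorem lemma2p4 (R : realType) (S : zmodType) (chi : mult_char S R[i]) :
  (exists sigma : lieAut (Ahat chi),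
    (forall (a : S) (m : int), sigma (A_ chi a m) = chi a *: A_ chi a m) /\
    (forall x : Ahat chi, tauB chi x = sigma (tauC chi (iso_inv sigma x)))) /\
  lie_isomorphic (Bhat chi) (Chat chi).
Proof.
split.
  exists (twist_aut chi chi); split=> [a m|x]; first exact: twist_A.
  by rewrite [RHS]twist_tauC [twist _ _]twist_char_invK.
exact: inhabits (lieIso_sym
  (fixed_iso (phi := twist_aut chi chi) (@twist_tauC _ _ chi))).
Qed.
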